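(* Let $q$ be a prime power and let $k\ge 2$, $n\ge1$ be integers. The following are equivalent: (i) there exists $x\in\mathbb F_{q^n}$ such that $\Delta(x,x^q,x^{q^2},\dots,x^{q^{k-1}})\ne 0$ and $\Delta_1(x,x^q,x^{q^2},\dots,x^{q^{k-1}})=0$; (ii) $X^n-1$ has a factor in $\mathbb F_q[X]$ of the form $X^k+a_{k-1}X^{k-1}+\cdots+a_2X^2+a_0$ (a monic polynomial of degree $k$ whose coefficient of $X$ is $0$).
   Context: $\Delta(X_1,\dots,X_k)=\det\bigl(X_j^{q^i}\bigr)_{0\le i\le k-1,\,1\le j\le k}$ is the Moore determinant over $\mathbb F_q$, and $\Delta_1(X_1,\dots,X_k)$ is the $k\times k$ determinant with rows $(X_1^{q^i},\dots,X_k^{q^i})$ for $i\in\{0,2,3,\dots,k\}$. *)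

(* Defs.v *)
From HB Require Import structures.
From mathcomp Require Import all_boot all_order all_algebra all_field.

Set Implicit Arguments.
Unset Strict Implicit.
Unset Printing Implicit Defensive.

Import GRing.Theory.
Local Open Scope ring_scope.

Definition moore_det (R : comNzRingType) (q k : nat) (X : 'rV[R]_k) : R :=
  \det (\matrix_(i < k, j < k) X 0 j ^+ (q ^ i)).

(* [bump 1] maps 0 to 0 and i to i.+1 for i >= 1, so the row exponents are
   q^0, q^2, q^3, ..., q^k. *)
Definition moore_det1 (R : comNzRingType) (q k : nat) (X : 'rV[R]_k) : R :=
  \det (\matrix_(i < k, j < k) X 0 j ^+ (q ^ bump 1 i)).

(* The vector (x, x^q, ..., x^(q^(k-1))). *)
Definition conj_row (R : comNzRingType) (q k : nat) (x : R) : 'rV[R]_k :=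
  \row_(j < k) x ^+ (q ^ j).

(* Main.v *)
(**
  Let q = #|F| and make L an F[X]-module by letting X act as the Frobenius
  x |-> x^q.  A Moore determinant vanishes iff its arguments are linearly
  dependent over F.  Transposing the matrix of Delta_1(x, x^q, ...) turns it
  into the Moore matrix of x, x^(q^2), ..., x^(q^k).  Hence (i) says that some
  x is killed by a nonzero polynomial of degree at most k without X-term, but
  by no nonzero polynomial of degree < k; such a polynomial generates the
  annihilator of x, so it divides X^n - 1.  Conversely every divisor of
  X^n - 1 generates the annihilator of some x in L: the kernel of a divisor P
  has dimension exactly deg P, and the annihilator is built up one irreducible
  factor at a time.
*)
Require Import Defs.
From HB Require Import structures.
From mathcomp Require Import all_boot all_order all_algebra all_field.
From mathcomp Require Import qpoly ring zify.

Set Implicit Arguments.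
Unset Strict Implicit.
Unset Printing Implicit Defensive.

Import GRing.Theory.
Local Open Scope ring_scope.

Import FalgLfun.

Lemma irreducible_dvdp (R : finFieldType) (D : {poly R}) : (1 < size D)%N ->
  exists2 p : {poly R}, irreducible_poly p & p %| D.
Proof.
have [m] := ubnP (size D); elim: m D => // m IHm D /ltnSE sDm D1.
case: (irreducibleP D) => [irrD | nirrD]; first by exists D.
have D0 : D != 0 by rewrite -size_poly_gt0 ltnW.
have : ~~ irreducibleb D by apply/irreducibleP.
rewrite /irreducibleb D1 negb_forall => /existsP[E].
rewrite negb_imply -Pdiv.Idomain.dvdpE -ltnNge => /andP[dvdED E1].
have sED : (size E < size D)%N.
  by have := size_npoly E; rewrite -ltnS prednK // ltnW.
have [p irrp pE] := IHm E (leq_trans sED sDm) E1.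
by exists p => //; apply: dvdp_trans dvdED.
Qed.

Lemma coef_sumZXn (R : nzRingType) m (c : 'I_m -> R) (e : 'I_m -> nat) j :
  injective e -> (\sum_i c i *: 'X^(e i))`_(e j) = c j.
Proof.
move=> inje; rewrite coef_sum (bigD1 j) //= coefZ coefXn eqxx mulr1.
rewrite big1 ?addr0 // => i ne_ij.
by rewrite coefZ coefXn (inj_eq inje) eq_sym (negPf ne_ij) mulr0.
Qed.

(** * The Frobenius action of polynomials on [L], and vanishing of Moore determinants *)

Section FrobeniusModule.

Variables (F : finFieldType) (L : fieldExtType F).
Implicit Types (x y : L) (P Q D : {poly F}).

Local Notation q := #|F|.

Definition frobenius_fun x := x ^+ q.

Lemma frobenius_is_linear : linear frobenius_fun.
Proof.
have [p p_pr charFp] := finPcharP F.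
move=> c x y; rewrite /frobenius_fun exprDn_pchar; last first.
  rewrite (card_pprimeChar charFp) pnatX orbC; apply/orP; right.
  by rewrite (eq_pnat _ (pcharf_eq (rmorph_pchar (in_alg L) charFp))) pnat_id.
by rewrite exprZn expf_card.
Qed.

HB.instance Definition _ := GRing.isLinear.Build F L L _ frobenius_fun
  frobenius_is_linear.

Definition frobenius : 'End(L) := linfun frobenius_fun.

Lemma frobeniusXE i x : (frobenius ^+ i) x = x ^+ (q ^ i).
Proof.
elim: i => [|i IHi]; first by rewrite id_lfunE.
by rewrite exprSr lfun_mulE IHi lfunE /= /frobenius_fun -exprM -expnSr.
Qed.

Lemma expr_cardX_sumZ m i (c : 'I_m -> F) (y : 'I_m -> L) :
  (\sum_j c j *: y j) ^+ (q ^ i) = \sum_j c j *: y j ^+ (q ^ i).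
Proof.
rewrite -frobeniusXE linear_sum /=.
by apply: eq_bigr => j _; rewrite linearZ /= frobeniusXE.
Qed.

Definition frobenius_act P : 'End(L) := horner_alg frobenius P.

Lemma frobenius_actM P Q x :
  frobenius_act (P * Q) x = frobenius_act P (frobenius_act Q x).
(* The product in ['End(L)] composes in reverse order, hence the commutation. *)
Proof. by rewrite mulrC /frobenius_act rmorphM lfun_mulE. Qed.

Lemma frobenius_actD P Q x :
  frobenius_act (P + Q) x = frobenius_act P x + frobenius_act Q x.
Proof. by rewrite /frobenius_act rmorphD add_lfunE. Qed.

Lemma frobenius_act_sumZXn m (c : 'I_m -> F) (e : 'I_m -> nat) x :
  frobenius_act (\sum_i c i *: 'X^(e i)) x = \sum_i c i *: x ^+ (q ^ e i).
Proof.
rewrite /frobenius_act rmorph_sum sum_lfunE /=.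
apply: eq_bigr => i _; rewrite linearZ /= rmorphXn /= horner_algX mulr_algl.
by rewrite scale_lfunE frobeniusXE.
Qed.

Lemma frobenius_actE P x :
  frobenius_act P x = \sum_(i < size P) P`_i *: x ^+ (q ^ i).
Proof. by rewrite -frobenius_act_sumZXn -poly_def coefK. Qed.

(* A nonzero q-polynomial of q-degree d has degree q^d, hence at most q^d
   roots. *)
Lemma dim_roots_qpoly (U : {vspace L}) m (p : {poly L}) : p != 0 ->
    (size p <= m)%N ->
    (forall x, x \in U -> \sum_(i < m) p`_i * x ^+ (q ^ i) = 0) ->
  (\dim U < size p)%N.
Proof.
move=> p0 pm pmU.
have pU x : x \in U -> \sum_(i < size p) p`_i * x ^+ (q ^ i) = 0.
  move=> xU; rewrite -[RHS](pmU x xU).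
  rewrite (big_ord_widen m (fun i => p`_i * x ^+ (q ^ i))) // big_mkcond /=.
  by apply: eq_bigr => i _; case: ltnP => // pi; rewrite nth_default ?mul0r.
have q1 : (1 < q)%N by apply: finNzRing_gt1.
have sp : (0 < size p)%N by rewrite size_poly_gt0.
pose T := \sum_(i < size p) p`_i *: 'X^(q ^ i) : {poly L}.
have sT : (size T <= (q ^ (size p).-1).+1)%N.
  apply: (leq_trans (size_sum _ _ _)); apply/bigmax_leqP => i _.
  apply: (leq_trans (size_scale_leq _ _)); rewrite size_polyXn ltnS.
  by rewrite leq_exp2l // -ltnS prednK.
have T0 : T != 0.
  apply: contraNneq p0 => T0; rewrite -lead_coef_eq0 lead_coefE.
  have := coef0 L (q ^ (size p).-1); rewrite -T0 coef_sum.
  have lp : ((size p).-1 < size p)%N by rewrite prednK.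
  rewrite (bigD1 (Ordinal lp)) //= coefZ coefXn eqxx mulr1 big1 ?addr0.
    by move=> ->.
  move=> i ne; rewrite coefZ coefXn eqn_exp2l // eq_sym.
  by rewrite -val_eqE in ne; rewrite (negPf ne) mulr0.
(* Seen as a finite field, [L] lets the [q ^ \dim U] elements of [U] be listed as roots of [T]. *)
pose fL := FinFieldExtType L.
pose rs := enum [pred x : fL | (x : L) \in U].
have rsT : all (root T) (rs : seq L).
  apply/allP => x; rewrite (mem_enum (T := fL)) inE => xU.
  apply/eqP; rewrite /T horner_sum -[RHS](pU x xU); apply: eq_bigr => i _.
  by rewrite hornerZ hornerXn.
have := max_poly_roots T0 rsT (enum_uniq _).
have -> : size (rs : seq L) = (q ^ \dim U)%N.
  rewrite -[LHS]cardE.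
  exact: (card_vspace (T := fL) (U : {vspace (finvect_type L)})).
move=> /leq_trans/(_ sT); rewrite ltnS leq_exp2l //.
by move=> h; rewrite (leq_ltn_trans h) // prednK.
Qed.

(** Raising a relation over [F] to the powers [q ^ i] gives a relation between the columns.
    Conversely, a vector in the left kernel is the coefficient list of a q-polynomial that vanishes
    at every [Y 0 j], hence on their span, which is then of dimension less than [m]. *)
Lemma moore_det_eq0P m (Y : 'rV[L]_m) :
  reflect (exists2 c : 'rV[F]_m, c != 0 & \sum_j c 0 j *: Y 0 j = 0)
          (moore_det q Y == 0).
Proof.
apply: (iffP idP) => [/det0P[v v0 vY] | [c c0 cY]]; last first.
  rewrite /moore_det -det_tr; apply/det0P; exists (map_mx (in_alg L) c).
    by rewrite map_mx_eq0.
  apply/rowP => i; rewrite !mxE.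
  transitivity ((\sum_j c 0 j *: Y 0 j) ^+ (q ^ i)); last first.
    by rewrite cY expr0n expn_eq0 eqn0Ngt (ltnW (finNzRing_gt1 F)).
  rewrite expr_cardX_sumZ; apply: eq_bigr => j _.
  by rewrite !mxE mulr_algl.
have [/existsP[c /andP[c0 /eqP cY]] | /existsPn nex] :=
  boolP [exists c : 'rV[F]_m, (c != 0) && (\sum_j c 0 j *: Y 0 j == 0)].
  by exists c.
pose X := [tuple Y 0 j | j < m].
have freeX : free X.
  apply/freeP => c cX j; have := nex (\row_j c j); rewrite negb_and negbK.
  case/orP => [/eqP/rowP/(_ j) | /negP[]]; first by rewrite !mxE.
  apply/eqP; rewrite -[RHS]cX; apply: eq_bigr => i _.
  by rewrite mxE -tnth_nth tnth_mktuple.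
pose p := rVpoly v.
have p0 : p != 0.
  by apply: contraNneq v0 => p0; rewrite -[v]rVpolyK -/p p0 linear0.
have spm : (size p <= m)%N by apply: size_poly.
have : (\dim <<X>> < size p)%N.
  apply: (dim_roots_qpoly p0 spm) => x /coord_span ->.
  under eq_bigr do rewrite expr_cardX_sumZ mulr_sumr.
  rewrite exchange_big big1 // => j _.
  have := congr1 (fun A : 'rV_m => A 0 j) vY; rewrite !mxE => vYj.
  transitivity (coord X j x *: 0 : L); last by rewrite scaler0.
  rewrite -[X in _ = _ *: X]vYj scaler_sumr; apply: eq_bigr => i _.
  by rewrite mxE coef_rVpoly_ord -scalerAr -tnth_nth tnth_mktuple.
by move=> /leq_trans/(_ spm); rewrite (eqP freeX) size_tuple ltnn.
Qed.

(** * Kernels and annihilators for the Frobenius action *)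

Lemma dim_lker_frobenius_act_lt P : P != 0 ->
  (\dim (lker (frobenius_act P)) < size P)%N.
Proof.
move=> P0; rewrite -(size_map_poly (in_alg L)).
apply: (dim_roots_qpoly _ (leqnn _)) => [|x]; first by rewrite map_poly_eq0.
rewrite memv_ker frobenius_actE size_map_poly => /eqP Px.
by rewrite -[RHS]Px; apply: eq_bigr => i _; rewrite coef_map mulr_algl.
Qed.

Local Notation N := ('X^(\dim {:L}) - 1 : {poly F}).

Lemma frobenius_act_Xn_sub1 x : frobenius_act N x = 0.
Proof.
rewrite /frobenius_act rmorphB rmorphXn rmorph1 /= horner_algX.
rewrite add_lfunE opp_lfunE frobeniusXE id_lfunE.
rewrite -(card_vspace (T := FinFieldExtType L) {:finvect_type L}).
rewrite card_vspacef.
by have := @expf_card (FinFieldExtType L) x => ->; rewrite subrr.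
Qed.

(** Write [N = Q * P]. The image of [P] lies in the kernel of [Q]; since both kernels are bounded by
    the degrees, which add up to [\dim {:L}], rank-nullity forces equality. *)
Lemma dim_lker_frobenius_act P : P %| N ->
  \dim (lker (frobenius_act P)) = (size P).-1.
Proof.
have N0 : N != 0 by rewrite -size_poly_gt0 size_XnsubC ?adim_gt0.
move=> PN; have P0 := dvdpN0 PN N0.
pose Q : {poly F} := N %/ P; have defN : N = Q * P by rewrite /Q divpK.
have Q0 : Q != 0 by apply: contraNneq N0; rewrite defN => ->; rewrite mul0r.
have im_ker : (limg (frobenius_act P) <= lker (frobenius_act Q))%VS.
  apply/subvP => _ /memv_imgP[x _ ->].
  by rewrite memv_ker -frobenius_actM -defN frobenius_act_Xn_sub1.
have := limg_ker_dim (frobenius_act P) {:L}; rewrite capfv.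
have : (\dim {:L}).+1 = (size Q + size P).-1.
  by rewrite -size_mul // -defN size_XnsubC ?adim_gt0.
have := dimvS im_ker; have := dim_lker_frobenius_act_lt P0.
have := dim_lker_frobenius_act_lt Q0.
move: (\dim _) (\dim _) (\dim _) (\dim _) => dQ dP dI n; lia.
Qed.

Lemma exists_annihilator D : D %| N ->
  exists x, forall P, (frobenius_act P x == 0) = (D %| P).
Proof.
have N0 : N != 0 by rewrite -size_poly_gt0 size_XnsubC ?adim_gt0.
have [m] := ubnP (size D); elim: m D => // m IHm D /ltnSE sDm DN.
have D0 := dvdpN0 DN N0.
have [D1 | D1] := leqP (size D) 1.
  exists 0 => P; rewrite linear0 eqxx; apply/esym/(dvdp_trans _ (dvd1p P)).
  by rewrite dvdp1 eqn_leq D1 size_poly_gt0.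
have [p irrp pD] := irreducible_dvdp D1.
have p0 := irredp_neq0 irrp; have p1 : (1 < size p)%N := irrp.1.
pose E : {poly F} := D %/ p; have defD : D = E * p by rewrite /E divpK.
have E0 : E != 0 by apply: contraNneq D0; rewrite defD => ->; rewrite mul0r.
have ED : E %| D by rewrite defD dvdp_mulr.
have sD : size D = (size E + size p).-1 by rewrite defD size_mul.
have sE : (size E < size D)%N by lia.
have [x1 annx1] := IHm E (leq_trans sE sDm) (dvdp_trans ED DN).
(* Counting dimensions shows that [p] maps the kernel of [D] onto that of [E], so [x1] lifts to some
   [x] killed by [D]. *)
pose K := (frobenius_act p @: lker (frobenius_act D))%VS.
have defK : K = lker (frobenius_act E).
  have sub : (K <= lker (frobenius_act E))%VS.
    apply/subvP => _ /memv_imgP[x Dx ->]; rewrite memv_ker -frobenius_actM.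
    by rewrite -defD -memv_ker.
  apply/eqP; rewrite -(dimv_leqif_eq sub) eqn_leq dimvS //=.
  have := limg_ker_dim (frobenius_act p) (lker (frobenius_act D)).
  have := dimvS (capvSr (lker (frobenius_act D)) (lker (frobenius_act p))).
  rewrite -/K !dim_lker_frobenius_act ?(dvdp_trans _ DN) //.
  by rewrite -size_poly_gt0 in E0; move: (\dim _) (\dim _) => d1 d2; lia.
have: x1 \in K by rewrite defK memv_ker annx1.
case/memv_imgP => x Dx px.
(* Any [P] killing such a [y] is [R * E]. Were [p] prime to [R], a Bezout relation multiplied by [E]
   would express [E] through [D] and [P], and [E] would kill [y]. *)
suff [y [Dy py Ey]] : exists y, [/\ frobenius_act D y = 0,
    frobenius_act p y = x1 & frobenius_act E y != 0].
  exists y => P; apply/idP/idP => [/eqP Py | /dvdpP[Q ->]]; last first.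
    by rewrite frobenius_actM Dy linear0.
  have : E %| P.
    by rewrite -annx1 -py -frobenius_actM mulrC frobenius_actM Py linear0.
  case/dvdpP => R defP; rewrite defP defD mulrC dvdp_mul2r //.
  apply: contraNT Ey; rewrite -irreducible_poly_coprime //.
  case/Bezout_eq1_coprimepP => [[u v] /= uv].
  have -> : E = u * D + v * P.
    by rewrite defD defP -[LHS]mul1r -uv; ring.
  by rewrite frobenius_actD !frobenius_actM Dy Py !linear0 addr0.
(* If E kills x, then p does not divide E and x can be shifted by a nonzero
   element of the kernel of p, which E does not kill. *)
move: Dx; rewrite memv_ker => /eqP Dx.
have [Ex | Ex] := eqVneq (frobenius_act E x) 0; last by exists x.
have npE : ~~ (p %| E).
  apply/negP => /dvdpP[G defE].
  (* If [E = G * p], then [G] kills [x1], so [E] divides the smaller [G]. *)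
  move: Ex; rewrite defE frobenius_actM -px => /eqP; rewrite annx1.
  have G0 : G != 0 by apply: contraNneq E0; rewrite defE => ->; rewrite mul0r.
  have sEG : size E = (size G + size p).-1 by rewrite defE size_mul.
  move=> /(dvdp_leq G0) leEG; have {leEG} : (size E <= size G)%N by [].
  by rewrite -size_poly_gt0 in G0; lia.
pose z := vpick (lker (frobenius_act p)).
have z0 : z != 0.
  rewrite vpick0 -dimv_eq0 dim_lker_frobenius_act ?(dvdp_trans pD) //.
  by lia.
have pz : frobenius_act p z = 0 by apply/eqP; rewrite -memv_ker memv_pick.
exists (x + z); rewrite !linearD /= Dx Ex -px pz addr0 !add0r; split=> //.
  by rewrite defD frobenius_actM pz linear0.
apply: contraNneq z0 => Ez; move: npE; rewrite -irreducible_poly_coprime //.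
case/Bezout_eq1_coprimepP => [[u v] /= uv].
have : frobenius_act (u * p + v * E) z = 0.
  by rewrite frobenius_actD !frobenius_actM pz Ez !linear0 addr0.
by rewrite uv /frobenius_act rmorph1 id_lfunE => ->.
Qed.

(** The exponents are left free to cover both determinants: [e j = j] for the first and
    [e j = bump 1 j] for the second. *)
Lemma moore_det_exprX_eq0P m (e : 'I_m -> nat) x :
  reflect (exists2 c : 'rV[F]_m, c != 0 &
             frobenius_act (\sum_j c 0 j *: 'X^(e j)) x = 0)
          (moore_det q (\row_j x ^+ (q ^ e j)) == 0).
Proof.
have sumE (c : 'rV[F]_m) : frobenius_act (\sum_j c 0 j *: 'X^(e j)) x =
    \sum_j c 0 j *: (\row_j x ^+ (q ^ e j)) 0 j.
  by rewrite frobenius_act_sumZXn; apply: eq_bigr => j _; rewrite mxE.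
by apply: (iffP (moore_det_eq0P _)) => -[c c0 cx]; exists c;
  rewrite ?sumE // -sumE.
Qed.

End FrobeniusModule.

(** * From the two determinant conditions to divisors of [X^n - 1], and back *)

Lemma moore_det1_conj_row (R : comNzRingType) q k (x : R) :
  moore_det1 q (conj_row q k x) = moore_det q (\row_(j < k) x ^+ (q ^ bump 1 j)).
Proof.
rewrite /moore_det -det_tr; congr (\det _); apply/matrixP => i j.
by rewrite !mxE exprAC.
Qed.

Theorem theorem4p12 (q k n : nat) (F : finFieldType) (L : fieldExtType F)
    (hq : #|F| = q) (hk : (2 <= k)%N) (hn : (1 <= n)%N)
    (hL : \dim {:L} = n) :
  (exists x : L, moore_det q (conj_row q k x) != 0
                 /\ moore_det1 q (conj_row q k x) = 0)
  <->
  (exists P : {poly F}, [/\ P \is monic, size P = k.+1, P`_1 = 0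
                          & P %| 'X^n - 1]).
Proof.
subst q n; pose bump1 (j : 'I_k) := bump 1 j.
have bump1_inj : injective bump1 by move=> i j /(can_inj (@bumpK 1)) /val_inj.
split=> [[x [det0 /eqP]] | [P [monP sP P1 PN]]].
  rewrite moore_det1_conj_row => /moore_det_exprX_eq0P[c c0].
  set P : {poly F} := \sum_j _ => Px.
  have nzP : P != 0.
    apply: contraNneq c0 => P0; apply/eqP/rowP => j.
    by rewrite mxE -(coef_sumZXn (c 0) j bump1_inj) -/P P0 coef0.
  have P1 : P`_1 = 0.
    rewrite coef_sum big1 // => j _; rewrite coefZ coefXn.
    by rewrite (negPf (neq_bump 1 j)) mulr0.
  have sPk : (size P <= k.+1)%N.
    apply: (leq_trans (size_sum _ _ _)); apply/bigmax_leqP => j _.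
    apply: (leq_trans (size_scale_leq _ _)); rewrite size_polyXn ltnS.
    by rewrite /bump; have := ltn_ord j; case: (1 <= j)%N => /= h; lia.
  (* The first determinant being nonzero, no nonzero polynomial of degree less than [k] kills
     [x]. *)
  have annx (R : {poly F}) : frobenius_act L R x = 0 -> (size R <= k)%N -> R = 0.
    move=> Rx sR; apply: contraNeq det0 => R0.
    apply/moore_det_exprX_eq0P; exists (poly_rV R).
      by apply: contraNneq R0 => R0; rewrite -(poly_rV_K sR) R0 linear0.
    rewrite -[RHS]Rx; congr (frobenius_act L _ x).
    under eq_bigr do rewrite mxE; rewrite -(poly_def k (nth 0 R)).
    apply/polyP => i; rewrite coef_poly; case: ltnP => // ki.
    by rewrite nth_default // (leq_trans sR).
  have sP : size P = k.+1.
    apply/eqP; rewrite eqn_leq sPk ltnNge; apply: contra nzP => sP.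
    by rewrite (annx P).
  exists ((lead_coef P)^-1 *: P); rewrite monicE lead_coefZ.
  rewrite mulVf ?lead_coef_eq0 // size_scale ?invr_eq0 ?lead_coef_eq0 //.
  split; rewrite ?coefZ ?P1 ?mulr0 //.
  (* The remainder of [X^n - 1] modulo [P] kills [x] and has size at most [k], so it is zero. *)
  rewrite dvdpZl ?invr_eq0 ?lead_coef_eq0 //; apply/modp_eq0P/annx; last first.
    by rewrite -ltnS -sP ltn_modp.
  have := frobenius_act_Xn_sub1 x; rewrite {1}(divp_eq ('X^_ - 1) P).
  by rewrite frobenius_actD frobenius_actM Px linear0 add0r.
have [x annx] := exists_annihilator PN.
exists x; split.
  (* A relation would be a nonzero multiple of [P] of size at most [k]. *)
  apply/moore_det_exprX_eq0P => -[c c0]; set R : {poly F} := \sum_j _ => /eqP.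
  rewrite annx => PR; have R0 : R != 0.
    apply: contraNneq c0 => R0; apply/eqP/rowP => j.
    by rewrite mxE -(coef_sumZXn (c 0) j val_inj) -/R R0 coef0.
  have := dvdp_leq R0 PR; rewrite sP ltnNge => /negP[].
  apply: (leq_trans (size_sum _ _ _)); apply/bigmax_leqP => j _.
  by apply: (leq_trans (size_scale_leq _ _)); rewrite size_polyXn.
apply/eqP; rewrite moore_det1_conj_row; apply/moore_det_exprX_eq0P.
exists (\row_j P`_(bump1 j)).
  (* The last entry is the leading coefficient of [P]: as [2 <= k], [bump 1] sends [k.-1] to [k]. *)
  have lt_k1 : (k.-1 < k)%N by rewrite prednK ?(ltnW hk).
  apply/eqP => /rowP/(_ (Ordinal lt_k1)); rewrite !mxE.
  have -> : bump1 (Ordinal lt_k1) = (size P).-1.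
    by rewrite sP /bump1 /bump /=; case: (ltnP 0 k.-1) => /= h; lia.
  by apply/eqP; rewrite -lead_coefE lead_coef_eq0 monic_neq0.
transitivity (frobenius_act L P x); last by apply/eqP; rewrite annx.
congr (frobenius_act L _ x); rewrite -[RHS]coefK poly_def sP.
have lt_1 : (1 < k.+1)%N by rewrite ltnS ltnW.
(* Splitting off the index 1 reindexes the other terms by [bump 1]. *)
rewrite (bigD1_ord (Ordinal lt_1)) //= P1 scale0r add0r.
by apply: eq_bigr => j _; rewrite mxE.
Qed.
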